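(* There exists a constant $c>0$ such that for all positive integers $N,M$ and every set system $\mathcal S$ consisting of $M$ subsets of $[N]$, with corresponding projection system $\mathcal P_{\mathcal S}$, if $\mathrm{QDisc}(\mathcal P_{\mathcal S})\ne 0$ then $$\mathrm{Disc}(\mathcal S)<\left(2c\max\left[\sqrt{\log(2M)},\ \frac{\log(2M)}{\mathrm{QDisc}(\mathcal P_{\mathcal S})}\right]+1\right)\mathrm{QDisc}(\mathcal P_{\mathcal S}).$$
   Context: $[N]=\{1,\dots,N\}$. A set system on $[N]$ is a subset $\mathcal S\subseteq 2^{[N]}$. A coloring of $[N]$ is a function $\chi:[N]\to\{1,-1\}$; put $\chi(S)=\sum_{s\in S}\chi(s)$. The (combinatorial) discrepancy is $\mathrm{Disc}(\mathcal S)=\min_{\chi\ \text{coloring}}\max_{S\in\mathcal S}|\chi(S)|$. $\mathcal M_N(\mathbb C)$ is the set of $N\times N$ complex matrices. A projection system in $\mathbb C^N$ is a finite set $\mathcal P$ of orthogonal projections, i.e. matrices $P\in\mathcal M_N(\mathbb C)$ with $P^2=P=P^*$. A quantum coloring is a Hermitian matrix $\chi\in\mathcal M_N(\mathbb C)$ all of whose eigenvalues lie in $\{1,-1\}$. With $[A,B]=AB-BA$ and $\mathrm{tr}^2(X)=(\mathrm{tr}\,X)^2$, $$\mathrm{QDisc}(\mathcal P)=\min_{\chi\ \text{quantum coloring}}\ \max_{P\in\mathcal P}\left[\mathrm{tr}^2(\chi P)+\mathrm{tr}(\chi[\chi,P]P)\right]^{1/2}$$ (the expression in brackets is always real and non-negative).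 For $S\subseteq[N]$, $P_S$ is the diagonal $N\times N$ matrix whose $i$-th diagonal entry is $1$ if $i\in S$ and $0$ otherwise; $\mathcal P_{\mathcal S}=\{P_S:S\in\mathcal S\}$. *)

(* Defs.v *)
From HB Require Import structures.
From mathcomp Require Import all_boot all_order all_algebra finmap.
From mathcomp Require Import all_classical all_reals all_analysis.
From mathcomp Require Import complex.
Set Implicit Arguments. Unset Strict Implicit. Unset Printing Implicit Defensive.
Import Order.TTheory GRing.Theory Num.Theory.
Import numFieldNormedType.Exports.
Local Open Scope ring_scope.

(* The ground set [N] is 'I_N.  A colour is a boolean b, standing for the sign
   (-1) ^+ b, so that colourings form a finite type. *)
Definition coloring (N : nat) := {ffun 'I_N -> bool}.

Definition coloring_sum N (chi : coloring N) (S : {set 'I_N}) : int :=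
  \sum_(s in S) (-1) ^+ chi s.

Definition coloring_disc N (SS : {set {set 'I_N}}) (chi : coloring N) : nat :=
  \max_(S in SS) `|coloring_sum chi S|%N.

Definition Disc N (SS : {set {set 'I_N}}) : nat :=
  coloring_disc SS [arg min_(chi < [ffun=> false] : coloring N)
                      coloring_disc SS chi].

Section Quantum.
Variable R : realType.
Local Notation C := R[i].

Definition orthogonal_projection N (P : 'M[C]_N) :=
  (P *m P == P) && (P \is hermsymmx).

Record projection_system N := ProjectionSystem {
  projections :> {fset 'M[C]_N};
  projectionsP :
    forall P, P \in projections -> orthogonal_projection P }.

Definition quantum_coloring N (chi : 'M[C]_N) :=
  chi \is hermsymmx /\ forall a, eigenvalue chi a -> a = 1 \/ a = -1.

Definition commutator N (A B : 'M[C]_N) := A *m B - B *m A.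

Definition quantum_sqdev N (chi P : 'M[C]_N) : C :=
  (\tr (chi *m P)) ^+ 2 + \tr (chi *m commutator chi P *m P).

(* quantum_sqdev is real and non-negative by quantum_sqdev_ge0 below, so that
   taking the real part loses nothing. *)
Definition quantum_dev N (chi P : 'M[C]_N) : R :=
  Num.sqrt (complex.Re (quantum_sqdev chi P)).

(* The maximum of non-negative numbers; an empty system gives 0. *)
Definition quantum_coloring_disc N (PP : {fset 'M[C]_N}) (chi : 'M[C]_N) : R :=
  \big[Num.max/0]_(P <- PP) quantum_dev chi P.

(* The infimum is attained: see QDisc_min below. *)
Definition QDisc N (PP : projection_system N) : R :=
  inf [set quantum_coloring_disc PP chi | chi in @quantum_coloring N]%classic.

Definition set_projection N (S : {set 'I_N}) : 'M[C]_N :=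
  diag_mx (\row_i (i \in S)%:R).

Fact set_projectionP N (SS : {set {set 'I_N}}) (P : 'M[C]_N) :
  P \in [fset set_projection S | S in SS]%fset -> orthogonal_projection P.
Proof.
case/imfsetP=> S _ ->; apply/andP; split.
  rewrite /set_projection mulmx_diag; apply/eqP; congr diag_mx.
  by apply/rowP=> i; rewrite !mxE -natrM mulnb andbb.
apply/is_hermitianmxP; rewrite expr0 scale1r tr_diag_mx map_diag_mx.
by congr diag_mx; apply/rowP=> i; rewrite !mxE rmorph_nat.
Qed.

Definition set_projection_system N (SS : {set {set 'I_N}}) :
  projection_system N := ProjectionSystem (@set_projectionP N SS).

Lemma hermsymmxP N (A : 'M[C]_N) :
  A \is hermsymmx <-> A = map_mx Num.conj A^T.
Proof.
by split=> [/is_hermitianmxP|H]; [|apply/is_hermitianmxP];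
  rewrite expr0 scale1r.
Qed.

Lemma quantum_coloringP N (chi : 'M[C]_N) :
  quantum_coloring chi <-> chi \is hermsymmx /\ chi *m chi = 1%:M.
Proof.
split=> -[chiH H]; split=> //.
  have /orthomx_spectralP := hermitian_normalmx chiH.
  set P := spectralmx chi; set d := spectral_diag chi => E.
  have Pu : P \in unitmx by exact: spectral_unit.
  have d2 : diag_mx d *m diag_mx d = 1%:M.
    rewrite mulmx_diag -diag_const_mx; congr diag_mx; apply/rowP=> i.
    rewrite !mxE; suff: eigenvalue chi (d 0 i).
      by move=> /H[] ->; rewrite ?mulrNN mulr1.
    apply/eigenvalueP; exists (row i P).
      rewrite {1}E !mulmxA -row_mul mulmxV// row1 -rowE row_diag_mx.
      by rewrite -scalemxAl -rowE.
    apply: contraTneq Pu => r0; rewrite -row_free_unit.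
    apply/negP=> /row_freeP[B] /(congr1 (row i)) /rowP/(_ i).
    by rewrite row_mul r0 mul0mx !mxE eqxx => /eqP; rewrite eq_sym oner_eq0.
  by rewrite E !mulmxA (mulmxK Pu) -!mulmxA [diag_mx d *m (_ *m _)]mulmxA d2
             mul1mx mulVmx.
move=> a /eigenvalueP[v va v0].
have : v = (a ^+ 2) *: v.
  by rewrite -{1}[v]mulmx1 -H mulmxA va -scalemxAl va scalerA.
move/eqP; rewrite -{1}[v]scale1r -subr_eq0 -scalerBl scaler_eq0 (negPf v0) orbF.
by rewrite subr_eq0 eq_sym sqrf_eq1 => /orP[] /eqP ->; [left|right].
Qed.

Lemma quantum_coloring_entry N (chi : 'M[C]_N) i j :
  quantum_coloring chi -> `|chi i j| <= 1.
Proof.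
case/quantum_coloringP=> /hermsymmxP h1 /matrixP/(_ i i) h2.
have {}h2 : \sum_k `|chi i k| ^+ 2 = 1.
  rewrite mxE in h2; rewrite mxE eqxx in h2; rewrite -[RHS]h2.
  apply: eq_bigr => k _; rewrite normCK; congr (_ * _).
  by rewrite {2}h1 !mxE.
rewrite -(@ler_pXn2r _ 2) ?nnegrE// expr1n -[leRHS]h2 (bigD1 j)//=.
by rewrite lerDl sumr_ge0// => k _; rewrite exprn_ge0.
Qed.

Lemma quantum_coloring1 N : quantum_coloring (1%:M : 'M[C]_N).
Proof.
by apply/quantum_coloringP; split; [exact: hermitian1mx_subproof|rewrite mulmx1].
Qed.

Lemma mxtrace_mul_conj_ge0 N (A : 'M[C]_N) : 0 <= \tr (A *m map_mx Num.conj A^T).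
Proof.
apply: sumr_ge0 => i _; rewrite mxE; apply: sumr_ge0 => j _.
by rewrite !mxE mul_conjC_ge0.
Qed.

(* In the order of R[i], 0 <= z means that z is real and non-negative. *)
Lemma quantum_sqdev_ge0 N (chi P : 'M[C]_N) :
  quantum_coloring chi -> orthogonal_projection P -> 0 <= quantum_sqdev chi P.
Proof.
move=> /quantum_coloringP[/hermsymmxP chiH chi2] /andP[/eqP P2 /hermsymmxP PH].
apply: addr_ge0.
  rewrite -realEsqr; apply/CrealP.
  rewrite -trace_map_mx -mxtrace_tr map_trmx trmx_mul map_mxM -chiH -PH.
  exact: mxtrace_mulC.
pose A := chi *m P - P *m chi *m P.
suff -> : \tr (chi *m commutator chi P *m P) = \tr (A *m map_mx Num.conj A^T).
  exact: mxtrace_mul_conj_ge0.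
have -> : map_mx Num.conj A^T = P *m chi - P *m chi *m P.
  rewrite /A linearB/= map_mxB !trmx_mul !map_mxM -chiH -PH mulmxA.
  by [].
have trB (Y Z : 'M[C]_N) : \tr (Y - Z) = \tr Y - \tr Z by exact: raddfB.
pose X := \tr (chi *m P *m chi *m P).
have -> : \tr (chi *m commutator chi P *m P) = \tr P - X.
  rewrite /commutator mulmxBr mulmxBl trB !mulmxA chi2 mul1mx.
  by rewrite P2.
have trBB (a b c d : 'M[C]_N) : \tr ((a - b) *m (c - d)) =
    \tr (a *m c) - \tr (a *m d) - (\tr (b *m c) - \tr (b *m d)).
  by rewrite mulmxBl 2!mulmxBr !trB.
have PP (a b : 'M[C]_N) : a *m P *m (P *m b) = a *m P *m b.
  by rewrite mulmxA -(mulmxA a) P2.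
have PPP (a b : 'M[C]_N) : a *m P *m (P *m b *m P) = a *m P *m b *m P.
  by rewrite -(mulmxA P) PP mulmxA.
have E1 : \tr (chi *m P *m (P *m chi)) = \tr P.
  by rewrite PP mxtrace_mulC mulmxA chi2 mul1mx.
have E2 : \tr (chi *m P *m (P *m chi *m P)) = X by rewrite PPP.
have E3 : \tr (P *m chi *m P *m (P *m chi)) = X.
  by rewrite PP mxtrace_mulC 2!mulmxA.
have E4 : \tr (P *m chi *m P *m (P *m chi *m P)) = X.
  by rewrite PPP mxtrace_mulC 3!mulmxA P2 -E3 PP.
by rewrite /A trBB E1 E2 E3 E4 subrr subr0.
Qed.

Local Notation Re := (@complex.Re R).
Local Notation Im := (@complex.Im R).
(* cc and ccm: continuity of complex- and matrix-valued maps, through the real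
   and imaginary parts (of the entries). *)
Let cc (T : topologicalType) (f : T -> C) : Prop :=
  continuous (Re \o f : T -> R) /\ continuous (Im \o f : T -> R).

Let ccD (T : topologicalType) (f g : T -> C) : cc f -> cc g -> cc (fun x => f x + g x).
Proof.
case=> f1 f2 [g1 g2]; split=> x.
  have -> : Re \o (fun x => f x + g x) = (Re \o f) \+ (Re \o g).
    by apply/funext=> y /=; case: (f y); case: (g y).
  by apply: cvgD; [exact: f1|exact: g1].
have -> : Im \o (fun x => f x + g x) = (Im \o f) \+ (Im \o g).
  by apply/funext=> y /=; case: (f y); case: (g y).
by apply: cvgD; [exact: f2|exact: g2].
Qed.

Let ccM (T : topologicalType) (f g : T -> C) : cc f -> cc g -> cc (fun x => f x * g x).
Proof.
case=> f1 f2 [g1 g2]; split=> x.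
  have -> : Re \o (fun x => f x * g x) =
    (Re \o f) \* (Re \o g) \- (Im \o f) \* (Im \o g).
    by apply/funext=> y /=; case: (f y); case: (g y).
  by apply: cvgB; apply: cvgM; [exact: f1|exact: g1|exact: f2|exact: g2].
have -> : Im \o (fun x => f x * g x) =
  (Re \o f) \* (Im \o g) \+ (Im \o f) \* (Re \o g).
  by apply/funext=> y /=; case: (f y); case: (g y).
by apply: cvgD; apply: cvgM; [exact: f1|exact: g2|exact: f2|exact: g1].
Qed.

Let cc_cst (T : topologicalType) (a : C) : cc (fun _ : T => a).
Proof. by split=> x; exact: cvg_cst. Qed.

Let cc_sum (T : topologicalType) (I : Type) (r : seq I) (f : I -> T -> C) :
  (forall i, cc (f i)) -> cc (fun x => \sum_(i <- r) f i x).
Proof.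
move=> cf; elim: r => [|i r IH].
  by under eq_fun do rewrite big_nil; exact: cc_cst.
by under eq_fun do rewrite big_cons; exact: ccD.
Qed.

Let cc_conj (T : topologicalType) (f : T -> C) : cc f -> cc (fun x => Num.conj (f x)).
Proof.
case=> f1 f2; split=> x.
  have -> : Re \o (fun x => Num.conj (f x)) = Re \o f.
    by apply/funext=> y /=; case: (f y).
  exact: f1.
have -> : Im \o (fun x => Num.conj (f x)) = \- (Im \o f).
  by apply/funext=> y /=; case: (f y).
by apply: cvgN; exact: f2.
Qed.

Let ccm (T : topologicalType) N (f : T -> 'M[C]_N) := forall i j, cc (fun x => f x i j).

Let ccm_mul (T : topologicalType) N (f g : T -> 'M[C]_N) :
  ccm f -> ccm g -> ccm (fun x => f x *m g x).
Proof.
move=> cf cg i j; under eq_fun do rewrite mxE.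
by apply: cc_sum => k; exact: ccM.
Qed.

Let ccm_sub (T : topologicalType) N (f g : T -> 'M[C]_N) :
  ccm f -> ccm g -> ccm (fun x => f x - g x).
Proof.
move=> cf cg i j; under eq_fun do rewrite !mxE -mulN1r.
by apply: ccD => //; apply: ccM => //; exact: cc_cst.
Qed.

Let ccm_adj (T : topologicalType) N (f : T -> 'M[C]_N) :
  ccm f -> ccm (fun x => map_mx Num.conj (f x)^T).
Proof. by move=> cf i j; under eq_fun do rewrite !mxE; exact: cc_conj. Qed.

Let ccm_cst (T : topologicalType) N (A : 'M[C]_N) : ccm (fun _ : T => A).
Proof. by move=> i j; exact: cc_cst. Qed.

Let continuous_disc (T : topologicalType) N (PP : {fset 'M[C]_N})
    (f : T -> 'M[C]_N) : ccm f ->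
  continuous ((fun x => quantum_coloring_disc PP (f x)) : T -> R).
Proof.
move=> cf; rewrite /quantum_coloring_disc; elim: (enum_fset PP) => [|P r IH].
  by under eq_fun do rewrite big_nil; move=> x; exact: cvg_cst.
under eq_fun do rewrite big_cons.
apply: max_fun_continuous => //.
have cP := @ccm_cst T N P.
have [c1 _] : cc (fun x => quantum_sqdev (f x) P).
  rewrite /quantum_sqdev; apply: ccD.
    under eq_fun do rewrite expr2.
    by apply: ccM; apply: cc_sum => i; exact: ccm_mul.
  apply: cc_sum => i; apply: ccm_mul => //; apply: ccm_mul => //.
  by apply: ccm_sub; exact: ccm_mul.
move=> x; apply: (@continuous_comp _ _ _ (Re \o (fun x => quantum_sqdev (f x) P))
                              (@Num.sqrt R)).
  exact: c1.
exact: sqrt_continuous.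
Qed.

Local Open Scope classical_set_scope.
Local Open Scope ring_scope.

Let closed_ccm (T : topologicalType) N (f : T -> 'M[C]_N) :
  ccm f -> closed [set x | f x = 0].
Proof.
move=> cf.
have -> : [set x | f x = 0] = \bigcap_(ij in [set: 'I_N * 'I_N])
   ((Re \o (fun x => f x ij.1 ij.2)) @^-1` [set 0] `&`
    (Im \o (fun x => f x ij.1 ij.2)) @^-1` [set 0])%classic.
  apply/seteqP; split=> x /=.
    by move=> fx0 ij _ /=; rewrite fx0 mxE.
  move=> H; apply/matrixP=> i j; have [/= h1 h2] := H (i, j) I.
  by rewrite mxE; apply/eqP; rewrite eq_complex h1 h2 !eqxx.
have cl (g : T -> R) : continuous g -> closed (g @^-1` [set 0]).
  by move=> cg; apply: preimage_closed; [move=> x _; exact: cg|exact: closed_eq].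
apply: closed_bigI => -[i j] _; have [c1 c2] := cf i j.
by apply: closedI; exact: cl.
Qed.

Let space (N : nat) := prod_topology (fun _ : 'I_N * 'I_N * bool => R).

Let mk N (f : space N) : 'M[C]_N :=
  \matrix_(i, j) Complex (f (i, j, true)) (f (i, j, false)).

Let ccm_mk N : ccm (@mk N).
Proof.
move=> i j; split=> x.
  have -> : Re \o (fun x => mk x i j) = proj (i, j, true).
    by apply/funext=> y /=; rewrite mxE.
  exact: proj_continuous.
have -> : Im \o (fun x => mk x i j) = proj (i, j, false).
  by apply/funext=> y /=; rewrite mxE.
exact: proj_continuous.
Qed.

Lemma QDisc_min N (PP : projection_system N) :
  exists2 chi, quantum_coloring chi &
    QDisc PP = quantum_coloring_disc PP chi /\
    forall chi', quantum_coloring chi' ->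
      quantum_coloring_disc PP chi <= quantum_coloring_disc PP chi'.
Proof.
pose B : set (space N) := [set f | forall i, `[-1, 1]%classic (f i)].
pose A : set (space N) := B `&` [set x | quantum_coloring (mk x)].
have cA : compact A.
  apply: compact_closedI.
    exact: (@tychonoff _ (fun=> R) (fun=> `[-1, 1]%classic)
             (fun=> @segment_compact R _ _)).
  have -> : [set x | quantum_coloring (@mk N x)] =
    [set x | mk x - map_mx Num.conj (mk x)^T = 0] `&` [set x | mk x *m mk x - 1%:M = 0].
    apply/seteqP; split=> x /=.
      by case/quantum_coloringP=> /hermsymmxP h1 h2; rewrite h2 {1}h1 !subrr.
    case=> /eqP; rewrite subr_eq0 => /eqP h1 /eqP; rewrite subr_eq0 => /eqP h2.
    by apply/quantum_coloringP; split=> //; apply/hermsymmxP.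
  apply: closedI; apply: closed_ccm.
    by apply: ccm_sub; [|apply: ccm_adj]; exact: ccm_mk.
  by apply: ccm_sub; [apply: ccm_mul; exact: ccm_mk|exact: ccm_cst].
have surj chi : quantum_coloring chi -> exists2 x, A x & mk x = chi.
  move=> qc; pose x : space N := fun k => if k.2 then Re (chi k.1.1 k.1.2)
                                     else Im (chi k.1.1 k.1.2).
  have xE : mk x = chi.
    by apply/matrixP=> i j; rewrite mxE /x /=; case: (chi i j).
  exists x; [split; last by rewrite /mkset xE|exact: xE].
  move=> -[[k l] b]; rewrite /mkset in_itv /= -ler_norml.
  have n1 := quantum_coloring_entry k l qc.
  rewrite /x; case: b => /=; rewrite -lecR; apply: le_trans n1.
    exact: complex.normc_ge_Re.
  rewrite -normrN -ReiNIm (le_trans (complex.normc_ge_Re _))// normrM.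
  by rewrite [X in _ * X]normc_def /= expr0n expr1n add0r sqrtr1 mulr1.
have [x0 Ax0 _] := surj _ (quantum_coloring1 N).
have cf : {within A,
    continuous ((fun x => quantum_coloring_disc PP (mk x)) : space N -> R)}.
  exact: (continuous_subspaceT (@continuous_disc _ _ PP _ (@ccm_mk N))).
have [|x /set_mem Ax minx] := compact_EVT_min _ cA cf; first by exists x0.
have lbx chi : quantum_coloring chi ->
    quantum_coloring_disc PP (mk x) <= quantum_coloring_disc PP chi.
  by move=> /surj[y Ay <-]; apply: minx; exact: mem_set.
exists (mk x); first by case: Ax.
split=> //; apply/eqP; rewrite /QDisc eq_le; apply/andP; split.
  apply: ge_inf; last by exists (mk x) => //; case: Ax.
  by exists (quantum_coloring_disc PP (mk x)) => _ [chi /lbx ? <-].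
apply: lb_le_inf; first by
  exists (quantum_coloring_disc PP (mk x)); exists (mk x) => //; case: Ax.
by move=> _ [chi /lbx ? <-].
Qed.
End Quantum.

(* Main.v *)
Require Import Defs.
From HB Require Import structures.
From mathcomp Require Import all_boot all_order all_algebra finmap.
From mathcomp Require Import all_classical all_reals all_analysis.
From mathcomp Require Import perm complex ring lra.
Import Order.TTheory GRing.Theory Num.Theory.
Local Open Scope ring_scope.

(* An optimal quantum coloring [chi] yields the projection [K = (1 + chi) / 2],
   and the determinantal point process with kernel [K] is a random subset [X];
   colour the points of [X] by [+1] and the others by [-1].  For a set [S] the
   number of points of [X] in [S] is distributed as a sum of independent
   Bernoulli variables, whose parameters are the eigenvalues of [P_S K P_S].
   Hence the colour sum of [S] has mean [tr (chi P_S)] and variance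
   [tr (chi [chi, P_S] P_S)], both controlled by the quantum discrepancy, and a
   Bernstein inequality with a union bound over the sets finishes the proof. *)

(** * Determinant identities *)

(** Sylvester's identity: [U *m V] and [V *m U] are both block lower triangular, and they have the
    same determinant. *)
Lemma det_addM_comm (R : comNzRingType) m n (A : 'M[R]_(m, n)) (B : 'M[R]_(n, m)) :
  \det (1%:M + A *m B) = \det (1%:M + B *m A).
Proof.
pose U : 'M[R]_(m + n) := block_mx 1%:M A 0 1%:M.
pose V : 'M[R]_(m + n) := block_mx 1%:M (- A) B 1%:M.
have UV : U *m V = block_mx (1%:M + A *m B) 0 B 1%:M.
  by rewrite mulmx_block !mul1mx !mulmx1 !mul0mx !add0r addNr.
have VU : V *m U = block_mx 1%:M 0 B (1%:M + B *m A).
  by rewrite mulmx_block !mul1mx !mulmx1 !mulmx0 !addr0 subrr addrC.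
have := congr1 determinant UV; have := congr1 determinant VU.
by rewrite !det_lblock !det1 mulr1 mul1r !det_mulmx mulrC => -> ->.
Qed.

(** Multilinearity in all rows at once. It later collapses the generating function of the
    determinantal weights into a single determinant. *)
Lemma det_row_choice (R : comNzRingType) n (a b : 'I_n -> R) (A B : 'M[R]_n) :
  \det (\matrix_(i, j) (a i * A i j + b i * B i j)) =
  \sum_(f : {ffun 'I_n -> bool}) (\prod_i (if f i then b i else a i)) *
    \det (\matrix_(i, j) (if f i then B i j else A i j)).
Proof.
rewrite /determinant.
under [RHS]eq_bigr do rewrite mulr_sumr; rewrite exchange_big/=.
apply: eq_bigr => s _.
pose F i (c : bool) := if c then b i * B i (s i) else a i * A i (s i).
have -> : \prod_i (\matrix_(i, j) (a i * A i j + b i * B i j)) i (s i) =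
    \prod_i \sum_c F i c.
  by apply: eq_bigr => i _; rewrite mxE big_bool addrC.
rewrite bigA_distr_bigA mulr_sumr; apply: eq_bigr => f _.
rewrite mulrCA -big_split; congr (_ * _); apply: eq_bigr => i _ /=.
by rewrite /F mxE; case: (f i).
Qed.

(** * Conjugate transposes *)

Definition adjmx {C : numClosedFieldType} {m n} (A : 'M[C]_(m, n)) : 'M[C]_(n, m) :=
  map_mx Num.conj A^T.

Section Adjoint.
Variable C : numClosedFieldType.
Implicit Types m n p : nat.

Lemma adjmxE m n (A : 'M[C]_(m, n)) i j : adjmx A i j = Num.conj (A j i).
Proof. by rewrite !mxE. Qed.

Lemma adjmxM m n p (A : 'M[C]_(m, n)) (B : 'M[C]_(n, p)) :
  adjmx (A *m B) = adjmx B *m adjmx A.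
Proof. by rewrite /adjmx trmx_mul map_mxM. Qed.

Lemma adjmxD m n (A B : 'M[C]_(m, n)) : adjmx (A + B) = adjmx A + adjmx B.
Proof. by rewrite /adjmx linearD map_mxD. Qed.

Lemma adjmxB m n (A B : 'M[C]_(m, n)) : adjmx (A - B) = adjmx A - adjmx B.
Proof. by rewrite /adjmx linearB map_mxB. Qed.

Lemma adjmxZ m n a (A : 'M[C]_(m, n)) : adjmx (a *: A) = Num.conj a *: adjmx A.
Proof. by rewrite /adjmx linearZ map_mxZ. Qed.

Lemma adjmx1 n : adjmx (1%:M : 'M[C]_n) = 1%:M.
Proof. by rewrite /adjmx trmx1 map_mx1. Qed.

Lemma det_adjmx n (A : 'M[C]_n) : \det (adjmx A) = Num.conj (\det A).
Proof. by rewrite /adjmx det_map_mx det_tr. Qed.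

Lemma mul_adjmx_diag m n (A : 'M[C]_(m, n)) i :
  (A *m adjmx A) i i = \sum_j `|A i j| ^+ 2.
Proof. by rewrite mxE; apply: eq_bigr => j _; rewrite adjmxE normCK. Qed.

Lemma mul_adjmx_diag_ge0 m n (A : 'M[C]_(m, n)) i : 0 <= (A *m adjmx A) i i.
Proof. by rewrite mul_adjmx_diag sumr_ge0// => j _; rewrite exprn_ge0. Qed.

Lemma mul_adjmx_row_gt0 n (v : 'rV[C]_n) : v != 0 -> 0 < (v *m adjmx v) 0 0.
Proof.
move=> v0; rewrite lt_def mul_adjmx_diag_ge0 andbT; apply: contra v0.
rewrite mul_adjmx_diag psumr_eq0 => [/allP h|j _]; last by rewrite exprn_ge0.
apply/eqP/rowP => j; rewrite mxE; apply/eqP.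
by have := h j (mem_index_enum _); rewrite expf_eq0/= normr_eq0.
Qed.

(** A row vector in the kernel satisfies [v = - t v U]; as [U] preserves norms,
    [|v|^2 = |t|^2 |v|^2], which is impossible for [v != 0]. *)
Lemma det1D_unitary_neq0 n (U : 'M[C]_n) (t : C) :
  U *m adjmx U = 1%:M -> `|t| < 1 -> \det (1%:M + t *: U) != 0.
Proof.
move=> UU t1; apply/det0P => -[v v0].
rewrite mulmxDr mulmx1 -scalemxAr => /eqP; rewrite addr_eq0 => /eqP vE.
have : (v *m adjmx v) 0 0 = `|t| ^+ 2 * (v *m adjmx v) 0 0.
  rewrite {1 2}vE -scaleN1r scalerA adjmxZ adjmxM -scalemxAl -scalemxAr scalerA.
  by rewrite mulmxA -(mulmxA v) UU mulmx1 mxE -normCK mulN1r normrN.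
move/eqP; apply/negP; rewrite -subr_eq0 -{1}[X in X - _]mul1r -mulrBl mulf_eq0 negb_or.
rewrite (gt_eqF (mul_adjmx_row_gt0 _ _ v0)) andbT subr_eq0 eq_sym.
by rewrite lt_eqF// expr_lt1.
Qed.

End Adjoint.

(** * Sign of determinants built from two reflections *)

Section ProductOfReflections.
Variable R : rcfType.
Local Notation C := R[i].

Lemma horner_map_Re (p : {poly C}) (t : R) :
  (map_poly (@complex.Re R) p).[t] = complex.Re p.[t%:C%C].
Proof.
rewrite horner_poly [p.[_]]horner_coef raddf_sum; apply: eq_bigr => i _.
rewrite /= -rmorphXn/=; case: (p`_i) => a b /=.
by rewrite mulr0 subr0.
Qed.

(* [\det (1 + t A B)] is real because [A B] and its adjoint [B A] yield the same
   determinant, and nonzero for [|t| < 1] because [A B] is unitary; so it keeps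
   the positive sign it has at [t = 0]. *)
Lemma det1D_mul_reflections_ge0 n (A B : 'M[C]_n) :
  adjmx A = A -> A *m A = 1%:M -> adjmx B = B -> B *m B = 1%:M ->
  0 <= \det (1%:M + A *m B).
Proof.
move=> Ah A2 Bh B2.
pose p : {poly C} := \det (1%:M + 'X *: map_mx polyC (A *m B)).
have pE (t : R) : p.[t%:C%C] = \det (1%:M + t%:C%C *: (A *m B)).
  rewrite /p -horner_evalE -det_map_mx; congr determinant.
  apply/matrixP => i j; rewrite !mxE /= horner_evalE hornerD hornerM hornerX hornerC.
  by rewrite hornerMn hornerC.
have AB1 : A *m B *m adjmx (A *m B) = 1%:M.
  by rewrite adjmxM Ah Bh mulmxA -(mulmxA A) B2 mulmx1.
have preal (t : R) : p.[t%:C%C] \is Num.real.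
  apply/CrealP; rewrite pE -det_adjmx adjmxD adjmx1 adjmxZ adjmxM Ah Bh.
  have -> : Num.conj (t%:C%C) = t%:C%C by exact: complex.conjc_real.
  by rewrite scalemxAl -det_addM_comm scalemxAr.
have pR (t : R) : p.[t%:C%C] = (complex.Re p.[t%:C%C])%:C%C.
  by rewrite RRe_real.
have := pE 1; rewrite scale1r => <-; rewrite pR ler0c.
rewrite leNgt; apply/negP => p1.
(* [poly_ivt] asks for a passage from nonpositive to nonnegative values, hence the negation. The
   root [t = 1] must be excluded separately, since unitarity only handles [t < 1]. *)
have [||t /andP[t0 t1]] := @poly_ivt R (- map_poly (@complex.Re R) p) 0 1 => //.
  rewrite !hornerN !horner_map_Re pE scale0r addr0 det1 /= oppr_le0 ler01/=.
  by rewrite oppr_ge0 ltW.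
rewrite rootN rootE horner_map_Re => /eqP pt.
move: t1; rewrite le_eqVlt => /orP[/eqP t1|t1].
  by move: p1; rewrite -t1 pt ltxx.
have nt : `|t%:C%C| < 1.
  by rewrite normc_def /= expr0n addr0 sqrtr_sqr ger0_norm// ltcR.
by have := det1D_unitary_neq0 _ _ _ _ AB1 nt; rewrite -pE pR pt eqxx.
Qed.
End ProductOfReflections.

(** * Bernoulli exponential moments and spectra of compressions *)

Section SpectralLaplace.
Variable R : realType.
Local Notation C := R[i].

(** Follows from [exp y <= 1 / (1 - y)], because [(1 - y) (1 + y + 2 y^2) = 1 + y^2 (1 - 2 y) >=
    1]. *)
Lemma expR_le_quadratic (y : R) : y <= 2^-1 -> expR y <= 1 + y + 2 * y ^+ 2.
Proof.
move=> y2; have h : 1 - y <= expR (- y) by exact: expR_ge1Dx.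
have y1 : 0 < 1 - y by lra.
apply: (@le_trans _ _ (1 - y)^-1).
  by rewrite -[y in leLHS]opprK expRN lef_pV2// posrE ?expR_gt0.
rewrite -[leLHS]mul1r ler_pdivrMr//; nra.
Qed.

(** Once [exp (s l)] is factored out, a centred Bernoulli variable remains: in the quadratic bounds
    the linear terms cancel and the others add up to [2 s^2 l (1 - l)]. *)
Lemma bernoulli_mgf_le (l s : R) : 0 <= l <= 1 -> `|s| <= 2^-1 ->
  1 + (expR s - 1) * l <= expR (s * l + 2 * s ^+ 2 * (l - l ^+ 2)).
Proof.
move=> /andP[l0 l1]; rewrite ler_norml => /andP[s0 s1].
have := @expR_le_quadratic (- (s * l)) ltac:(nra).
have := @expR_le_quadratic (s * (1 - l)) ltac:(nra).
set x := expR (s * (1 - l)); set y := expR (- (s * l)) => hx hy.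
have -> : 1 + (expR s - 1) * l = expR (s * l) * ((1 - l) * y + l * x).
  rewrite mulrDr !mulrA ![expR _ * _]mulrC -!mulrA -!expRD.
  have -> : s * l + - (s * l) = 0 by ring.
  have -> : s * l + s * (1 - l) = s by ring.
  by rewrite expR0; ring.
rewrite expRD ler_pM2l ?expR_gt0//; apply: le_trans (expR_ge1Dx _).
have hx' := ler_wpM2l l0 hx.
have l1' : 0 <= 1 - l by lra.
have hy' := ler_wpM2l l1' hy.
by apply: le_trans (lerD hy' hx') _; lra.
Qed.

(* The [l k] are the eigenvalues of the compression [P K P]. *)
Lemma projection_compression_spectrum n (K P : 'M[C]_n) :
  adjmx K = K -> K *m K = K -> adjmx P = P -> P *m P = P ->
  exists l : 'I_n -> R, [/\ forall k, 0 <= l k <= 1,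
    forall z, \det (1%:M + z *: (P *m K)) = \prod_k (1 + z * (l k)%:C%C),
    \tr (K *m P) = (\sum_k l k)%:C%C &
    \tr (K *m P *m K *m P) = (\sum_k l k ^+ 2)%:C%C].
Proof.
move=> Kh K2 Ph P2; pose H := P *m K *m P.
have Hh : H \is hermsymmx.
  by apply/hermsymmxP; rewrite -/(adjmx H) !adjmxM Kh Ph mulmxA.
have /orthomx_spectralP := hermitian_normalmx Hh.
have Uu : spectralmx H \in unitmx by exact: spectral_unit.
have := spectral_unitarymx H => /unitarymxP.
move: Uu; set U := spectralmx H; set d := spectral_diag H => Uu UU HE.
have {}UU : U *m adjmx U = 1%:M by [].
have UH : U *m H *m adjmx U = diag_mx d.
  by rewrite HE !mulmxA mulmxV// mul1mx -mulmxA UU mulmx1.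
(* [H] is the Gram matrix [(P K) (P K)^*]. *)
have d0 k : 0 <= d 0 k.
  have -> : d 0 k = (U *m P *m K *m adjmx (U *m P *m K)) k k.
    rewrite !adjmxM Kh Ph -!mulmxA (mulmxA K K) K2 !mulmxA.
    by rewrite -2!(mulmxA U) UH mxE eqxx.
  exact: mul_adjmx_diag_ge0.
(* [1 - H = (1 - P) + P (1 - K) P] is a sum of two Gram matrices. *)
have d1 k : 0 <= 1 - d 0 k.
  pose Y := U *m P *m (1%:M - K).
  have -> : 1 - d 0 k = (U *m (1%:M - P) *m adjmx (U *m (1%:M - P))) k k +
                        (Y *m adjmx Y) k k.
    have -> : U *m (1%:M - P) *m adjmx (U *m (1%:M - P)) = 1%:M - U *m P *m adjmx U.
      rewrite adjmxM adjmxB adjmx1 Ph mulmxA -(mulmxA U).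
      rewrite mulmxBr mulmx1 mulmxBl mul1mx P2 subrr subr0.
      by rewrite mulmxBr mulmx1 mulmxBl UU.
    have -> : Y *m adjmx Y = U *m P *m adjmx U - diag_mx d.
      rewrite /Y !adjmxM adjmxB adjmx1 Kh Ph !mulmxA -(mulmxA (U *m P)).
      rewrite mulmxBr mulmx1 mulmxBl mul1mx K2 subrr subr0.
      rewrite mulmxBr mulmx1 !mulmxBl -(mulmxA U P P) P2; congr (_ - _).
      by rewrite -UH !mulmxA.
    by rewrite !mxE eqxx mulr1n addrA subrK.
  by rewrite addr_ge0// mul_adjmx_diag_ge0.
have dR k : d 0 k = (complex.Re (d 0 k))%:C%C.
  by rewrite RRe_real//; apply: ger0_real.
exists (fun k => complex.Re (d 0 k)); split.
- move=> k; move: (d0 k) (d1 k); rewrite dR -(rmorph1 (real_complex R)) -rmorphB.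
  by rewrite !ler0c /= subr_ge0 => -> ->.
- move=> z.
  (* With [P K = P (P K)], Sylvester's identity replaces [P K] by the Hermitian [H]. *)
  have -> : \det (1%:M + z *: (P *m K)) = \det (1%:M + z *: H).
    rewrite -{1}P2 -mulmxA scalemxAr det_addM_comm -scalemxAl.
    by rewrite /H.
  have -> : 1%:M + z *: H = invmx U *m (1%:M + z *: diag_mx d) *m U.
    rewrite mulmxDr mulmx1 mulmxDl mulVmx// -scalemxAr -scalemxAl.
    by rewrite -HE.
  rewrite -mulmxA det_mulmx mulrC det_mulmx -mulrA -det_mulmx mulmxV// det1 mulr1.
  have -> : 1%:M + z *: diag_mx d = diag_mx (\row_k (1 + z * d 0 k)).
    by apply/matrixP => i j; rewrite !mxE; case: eqP => [->|_];
      rewrite ?mulr1n// !mulr0n mulr0 addr0.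
  by rewrite det_diag; apply: eq_bigr => k _; rewrite mxE -dR.
- have -> : \tr (K *m P) = \tr H.
    by rewrite /H [RHS]mxtrace_mulC mulmxA P2 mxtrace_mulC.
  rewrite HE mxtrace_mulC mulmxA mulmxV// mul1mx mxtrace_diag.
  by rewrite rmorph_sum; apply: eq_bigr => k _; exact: dR.
have -> : \tr (K *m P *m K *m P) = \tr (H *m H).
  have -> : H *m H = P *m (K *m P *m K *m P).
    by rewrite /H !mulmxA -(mulmxA (P *m K) P P) P2.
  by rewrite [RHS]mxtrace_mulC -!mulmxA P2.
have -> : H *m H = invmx U *m (diag_mx d *m diag_mx d) *m U.
  by rewrite {1 2}HE !mulmxA mulmxK.
rewrite mulmx_diag mxtrace_mulC mulmxA mulmxV// mul1mx mxtrace_diag.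
by rewrite rmorph_sum; apply: eq_bigr => k _; rewrite mxE {1 2}dR rmorphXn/= expr2.
Qed.
End SpectralLaplace.

(** * The determinantal random coloring *)

Section RandomColoring.
Variables (R : realType) (N : nat).
Local Notation C := R[i].
Variable chi : 'M[C]_N.
Hypothesis chiQ : quantum_coloring chi.

Definition dpp_kernel : 'M[C]_N := 2^-1 *: (1%:M + chi).

Local Notation K := dpp_kernel.
Local Notation P := (@set_projection R N).

(* [f] indicates the complement of the point set, as the colour [true] is [-1]. *)
Definition dpp_weight (f : coloring N) : C :=
  \det (\matrix_(i, j) (if f i then (1%:M - K) i j else K i j)).

Let chih : adjmx chi = chi.
Proof. by case/quantum_coloringP: chiQ => /hermsymmxP. Qed.

Let chi2 : chi *m chi = 1%:M.
Proof. by case/quantum_coloringP: chiQ. Qed.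

Let half_addK (a : C) : 2^-1 * (a + a) = a.
Proof. by field. Qed.

Let Kh : adjmx K = K.
Proof. by rewrite /dpp_kernel adjmxZ adjmxD adjmx1 chih fmorphV rmorph_nat. Qed.

Let K2 : K *m K = K.
Proof.
rewrite /dpp_kernel -scalemxAl -scalemxAr mulmxDl mul1mx mulmxDr mulmx1 chi2.
rewrite (addrC chi); congr (_ *: _).
by apply/matrixP => i j; rewrite !mxE half_addK.
Qed.

Let chiE : chi = K + K - 1%:M.
Proof.
by apply/matrixP => i j; rewrite !mxE; set e : C := _%:R; field.
Qed.

(** Up to the factor 1/2, row [i] is the row of [1 + chi] or of [1 - chi], so the matrix is
    [(1 + E chi) / 2] with [E] diagonal of signs; [E] and [chi] are reflections. *)
Lemma dpp_weight_ge0 f : 0 <= dpp_weight f.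
Proof.
pose E : 'M[C]_N := diag_mx (\row_i (-1) ^+ f i).
have -> : dpp_weight f = \det (2^-1 *: (1%:M + E *m chi)).
  congr determinant; apply/matrixP => i j; rewrite mul_diag_mx !mxE.
  case: (f i); rewrite ?expr0 ?mul1r// expr1 mulN1r.
  set a : C := _%:R; rewrite -[X in X - _](half_addK a) -mulrBr.
  by rewrite opprD addrA addrK.
rewrite detZ mulr_ge0 ?exprn_ge0 ?invr_ge0//.
apply: det1D_mul_reflections_ge0 => //.
  by rewrite /adjmx tr_diag_mx map_diag_mx; congr diag_mx; apply/rowP => i;
    rewrite !mxE rmorph_sign.
rewrite mulmx_diag -diag_const_mx; congr diag_mx; apply/rowP => i.
by rewrite !mxE -expr2 sqrr_sign.
Qed.

(** The expectation of the product of [a i] over the random points. Row [i] on the right is [a i]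
    times that of [K] plus that of [1 - K], so [det_row_choice] applies. *)
Lemma dpp_weight_generating (a : 'I_N -> C) :
  \sum_(f : coloring N) (\prod_i (if f i then 1 else a i)) * dpp_weight f =
  \det (1%:M + diag_mx (\row_i (a i - 1)) *m K).
Proof.
rewrite -(det_row_choice _ _ a (fun=> 1)); congr determinant.
apply/matrixP => i j; rewrite mul_diag_mx !mxE; ring.
Qed.

Lemma sum_dpp_weight : \sum_(f : coloring N) dpp_weight f = 1.
Proof.
transitivity (\sum_(f : coloring N) (\prod_i (if f i then 1 else 1 : C)) * dpp_weight f).
  apply: eq_bigr => f _; rewrite big1 ?mul1r// => i _.
  by case: (f i).
rewrite (dpp_weight_generating (fun=> 1)).
have -> : (\row_i (1 - 1)) = 0 :> 'rV[C]_N by apply/rowP => i; rewrite !mxE subrr.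
by rewrite linear0 mul0mx addr0 det1.
Qed.

Lemma adjmx_set_projection S : adjmx (P S) = P S.
Proof.
rewrite /adjmx tr_diag_mx map_diag_mx; congr diag_mx; apply/rowP => i.
by rewrite !mxE rmorph_nat.
Qed.

Lemma set_projection_idem S : P S *m P S = P S.
Proof.
rewrite /set_projection mulmx_diag; congr diag_mx; apply/rowP => i.
by rewrite !mxE -natrM mulnb andbb.
Qed.

Lemma mxtrace_set_projection S : \tr (P S) = #|S|%:R.
Proof.
rewrite mxtrace_diag -sum1_card natr_sum [RHS]big_mkcond; apply: eq_bigr => i _ /=.
by rewrite mxE; case: (i \in S).
Qed.

(** If [k] points of [S] get colour [+1], the sum is [2 k - #|S|]. The product has the shape
    evaluated by [dpp_weight_generating]. *)
Lemma coloring_sum_expR (f : coloring N) (S : {set 'I_N}) (s : R) :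
  expR (s * (coloring_sum f S)%:~R) =
  expR (- (s * #|S|%:R)) *
  \prod_i (if f i then 1 else if i \in S then expR (2 * s) else 1).
Proof.
have -> : expR (- (s * #|S|%:R)) = \prod_(i in S) expR (- s) :> R.
  by rewrite prodr_const -expRM_natl mulrN mulr_natr mulr_natl.
rewrite [\prod_i _](_ : _ = \prod_(i in S) (if f i then 1 else expR (2 * s))).
  rewrite -big_split /= /coloring_sum rmorph_sum mulr_sumr expR_sum.
  apply: eq_bigr => i _; rewrite rmorph_sign; case: (f i).
    by rewrite expr1 mulrN1 mulr1.
  by rewrite expr0 -expRD; congr expR; ring.
rewrite [RHS]big_mkcond; apply: eq_bigr => i _.
by case: (f i); case: (i \in S).
Qed.

(** Substituting [chi = 2 K - 1] reduces both traces to those of [K P] and its square. The factor 4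
    is the effect on Bernoulli variances of doubling the count. *)
Lemma set_projection_spectrum (S : {set 'I_N}) :
  exists l : 'I_N -> R, [/\ forall k, 0 <= l k <= 1,
    forall z, \det (1%:M + z *: (P S *m K)) = \prod_k (1 + z * (l k)%:C%C),
    \tr (chi *m P S) = (2 * \sum_k l k - #|S|%:R)%:C%C &
    \tr (chi *m commutator chi (P S) *m P S) =
      (4 * \sum_k (l k - l k ^+ 2))%:C%C].
Proof.
have [l [l01 detE trE tr2E]] := projection_compression_spectrum _ _ _ _ Kh K2
  (adjmx_set_projection S) (set_projection_idem S).
exists l; split=> //.
  rewrite {1}chiE mulmxBl mulmxDl mul1mx linearB linearD /= trE.
  rewrite mxtrace_set_projection rmorphB rmorphM /= !rmorph_nat.
  by rewrite mulr_natl mulr2n.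
have -> : chi *m commutator chi (P S) *m P S = P S - chi *m P S *m chi *m P S.
  rewrite /commutator mulmxBr mulmxBl !mulmxA chi2 mul1mx.
  by rewrite set_projection_idem.
pose X := K *m P S.
have trXX : \tr (X *m X) = (\sum_k l k ^+ 2)%:C%C by rewrite -tr2E mulmxA.
have trXP : \tr (X *m P S) = (\sum_k l k)%:C%C.
  by rewrite -mulmxA set_projection_idem.
have trPX : \tr (P S *m X) = (\sum_k l k)%:C%C by rewrite mxtrace_mulC.
have -> : chi *m P S *m chi *m P S = (X + X - P S) *m (X + X - P S).
  have <- : chi *m P S = X + X - P S by rewrite {1}chiE mulmxBl mulmxDl mul1mx.
  by rewrite mulmxA.
rewrite mulmxBl !mulmxBr !mulmxDl !mulmxDr set_projection_idem.
rewrite !raddfB /= !raddfD /= trXX trXP trPX sumrB.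
rewrite rmorphM rmorphB /= rmorph_nat; ring.
Qed.

(** Both traces are real by [set_projection_spectrum], so the real part distributes over the sum and
    the square. *)
Lemma quantum_dev_sqr S :
  quantum_dev chi (P S) ^+ 2 = complex.Re (\tr (chi *m P S)) ^+ 2 +
    complex.Re (\tr (chi *m commutator chi (P S) *m P S)) /\
  0 <= complex.Re (\tr (chi *m commutator chi (P S) *m P S)).
Proof.
have [l [l01 _ t1 t2]] := set_projection_spectrum S.
have v0 : 0 <= 4 * \sum_k (l k - l k ^+ 2).
  rewrite mulr_ge0// sumr_ge0// => k _; have /andP[] := l01 k; nra.
rewrite /quantum_dev /quantum_sqdev t1 t2 -rmorphXn -rmorphD /=.
by rewrite sqr_sqrtr// addr_ge0// sqr_ge0.
Qed.

(** The generating function factors over the eigenvalues, and [bernoulli_mgf_le] bounds each factor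
    at [2 s]; hence the range [1/4]. *)
Lemma dpp_coloring_sum_mgf S (s : R) : `|s| <= 4^-1 ->
  \sum_(f : coloring N) complex.Re (dpp_weight f) *
    expR (s * ((coloring_sum f S)%:~R - complex.Re (\tr (chi *m P S)))) <=
  expR (2 * s ^+ 2 * complex.Re (\tr (chi *m commutator chi (P S) *m P S))).
Proof.
move=> s4; have [l [l01 detE -> ->]] := set_projection_spectrum S => /=.
have -> : \sum_(f : coloring N) complex.Re (dpp_weight f) *
      expR (s * ((coloring_sum f S)%:~R - (2 * \sum_k l k - #|S|%:R))) =
    expR (- (s * (2 * \sum_k l k))) * \prod_k (1 + (expR (2 * s) - 1) * l k).
  move: (\sum_k l k) => m; apply: complexI; rewrite rmorphM rmorph_prod /=.
  have -> : \prod_k (1 + (expR (2 * s) - 1) * l k)%:C%C =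
      \det (1%:M + (expR (2 * s) - 1)%:C%C *: (P S *m K)) :> C.
    by rewrite detE; apply: eq_bigr => k _; rewrite rmorphD rmorphM rmorph1.
  (* The generating function is evaluated at [exp (2 s)] on [S] and at 1 elsewhere. *)
  pose a i : R := if i \in S then expR (2 * s) else 1.
  have -> : (expR (2 * s) - 1)%:C%C *: (P S *m K) =
      diag_mx (\row_i ((a i)%:C%C - 1)) *m K.
    rewrite scalemxAl; congr (_ *m _); rewrite /set_projection -linearZ.
    congr diag_mx; apply/rowP => i; rewrite !mxE /a; case: (i \in S).
      by rewrite mulr1 rmorphB.
    by rewrite mulr0 subrr.
  rewrite -dpp_weight_generating mulr_sumr rmorph_sum; apply: eq_bigr => f _.
  rewrite rmorphM /= RRe_real ?ger0_real ?dpp_weight_ge0// [LHS]mulrC [RHS]mulrA.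
  congr (_ * _).
  have -> : s * ((coloring_sum f S)%:~R - (2 * m - #|S|%:R)) =
     s * (coloring_sum f S)%:~R + s * #|S|%:R + - (s * (2 * m)) by ring.
  rewrite expRD rmorphM /= [LHS]mulrC; congr (_ * _).
  rewrite expRD coloring_sum_expR mulrAC -expRD addNr expR0 mul1r rmorph_prod.
  by apply: eq_bigr => i _ /=; case: (f i).
have -> : 2 * s ^+ 2 * (4 * \sum_k (l k - l k ^+ 2)) = - (s * (2 * \sum_k l k)) +
   \sum_k ((2 * s) * l k + 2 * (2 * s) ^+ 2 * (l k - l k ^+ 2)).
  by rewrite [X in _ = _ + X]big_split /= -!mulr_sumr; ring.
rewrite expRD ler_pM2l ?expR_gt0// expR_sum; apply: ler_prod => k _.
apply/andP; split.
  have /andP[lk0 lk1] := l01 k.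
  have := expR_gt0 (2 * s); nra.
apply: bernoulli_mgf_le => //.
by rewrite normrM ger0_norm//; lra.
Qed.

End RandomColoring.

(** * Derandomisation *)

(* A Chernoff bound and a union bound, both at the same exponent [s]. *)
Lemma exists_coloring_near (R : realType) (N : nat) (SS : {set {set 'I_N}})
    (chi : 'M[R[i]]_N) (s V : R) :
  (0 < #|SS|)%N -> quantum_coloring chi -> 0 < s -> s <= 4^-1 ->
  (forall S, S \in SS ->
    complex.Re (\tr (chi *m commutator chi (set_projection R S) *m
                    set_projection R S)) <= V) ->
  exists f : coloring N, forall S, S \in SS ->
    `|(coloring_sum f S)%:~R - complex.Re (\tr (chi *m set_projection R S))| <=
      (ln (2 * #|SS|%:R) + 2 * s ^+ 2 * V) / s.
Proof.
move=> SS0 chiQ s0 s4 hV.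
pose Y f S : R :=
  (coloring_sum f S)%:~R - complex.Re (\tr (chi *m set_projection R S)).
pose w f := complex.Re (dpp_weight _ _ chi f).
pose G f : R := \sum_(S in SS) (expR (s * Y f S) + expR (- s * Y f S)).
have w1 : \sum_f w f = 1.
  by rewrite -raddf_sum sum_dpp_weight.
have w0 f : 0 <= w f.
  by rewrite -ler0c RRe_real ?ger0_real ?dpp_weight_ge0.
(* [exp B] counts two tails for each of the [#|SS|] sets. *)
set B := ln (2 * #|SS|%:R) + 2 * s ^+ 2 * V.
have Gavg : \sum_f w f * G f <= expR B.
  have -> : expR B = \sum_(S in SS) (expR (2 * s ^+ 2 * V) + expR (2 * s ^+ 2 * V)).
    rewrite sumr_const expRD lnK ?posrE ?mulr_gt0 ?ltr0n// -[RHS]mulr_natr; ring.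
  rewrite (eq_bigr (fun f => \sum_(S in SS)
     (w f * expR (s * Y f S) + w f * expR (- s * Y f S)))); last first.
    by move=> f _; rewrite mulr_sumr; apply: eq_bigr => S _; rewrite mulrDr.
  rewrite exchange_big /=; apply: ler_sum => S SSS; rewrite big_split /=.
  have expV : expR (2 * s ^+ 2 * complex.Re (\tr (chi *m
      commutator chi (set_projection R S) *m set_projection R S))) <=
      expR (2 * s ^+ 2 * V).
    by rewrite ler_expR ler_pM2l ?hV// mulr_gt0// exprn_gt0.
  apply: lerD; apply: le_trans expV.
    by apply: dpp_coloring_sum_mgf => //; rewrite ger0_norm// ltW.
  rewrite -(sqrrN s); apply: dpp_coloring_sum_mgf => //.
  by rewrite normrN ger0_norm// ltW.
(* Otherwise every [G f - exp B] is positive, yet their weighted sum is at most 0 although some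
   weight is nonzero. *)
have [f Gf] : exists f, G f <= expR B.
  apply/not_existsP => h.
  have {}h f : expR B < G f by rewrite ltNge; apply/negP/h.
  have : \sum_f w f * (G f - expR B) <= 0.
    rewrite (eq_bigr (fun f => w f * G f - w f * expR B)); last first.
      by move=> f _; rewrite mulrBr.
    by rewrite sumrB -mulr_suml w1 mul1r subr_le0.
  apply/negP; rewrite -ltNge lt_def sumr_ge0 ?andbT; last first.
    by move=> f _; rewrite mulr_ge0// subr_ge0 ltW.
  rewrite psumr_neq0; last by move=> f _; rewrite mulr_ge0// subr_ge0 ltW.
  have : \sum_f w f != 0 by rewrite w1 oner_eq0.
  rewrite psumr_neq0// => /hasP[f fin wf]; apply/hasP; exists f => //=.
  by rewrite mulr_gt0 ?subr_gt0.
exists f => S SSS; rewrite ler_pdivlMr// -[s in leLHS]gtr0_norm// -normrM mulrC.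
have {}Gf : expR (s * Y f S) + expR (- s * Y f S) <= expR B.
  by apply: le_trans Gf; rewrite /G (bigD1 S)//= lerDl sumr_ge0.
rewrite ler_norml lerNl -mulNr; apply/andP; split; rewrite -ler_expR.
  by apply: le_trans Gf; rewrite lerDr expR_ge0.
by apply: le_trans Gf; rewrite lerDl expR_ge0.
Qed.

(** * Comparison of the two discrepancies *)

Lemma Disc_le (N : nat) (SS : {set {set 'I_N}}) (f : coloring N) :
  (Disc SS <= coloring_disc SS f)%N.
Proof. by rewrite /Disc; case: arg_minnP => // g _; apply. Qed.

Lemma coloring_disc_le (R : realType) (N : nat) (SS : {set {set 'I_N}})
    (f : coloring N) (B : R) : 0 <= B ->
  (forall S, S \in SS -> `|(coloring_sum f S)%:~R| <= B) ->
  (coloring_disc SS f)%:R <= B.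
Proof.
move=> B0 h; rewrite /coloring_disc; elim/big_ind: _ => // [m n hm hn|S /h].
  by rewrite /maxn; case: ifP.
by rewrite -intr_norm -abszE.
Qed.

(** The squared deviation is a sum of two nonnegative terms, so its bound [q ^+ 2] holds for
    each. *)
Lemma quantum_coloring_disc_ge (R : realType) (N : nat) (SS : {set {set 'I_N}})
    (chi : 'M[R[i]]_N) (S : {set 'I_N}) : quantum_coloring chi -> S \in SS ->
  let P := set_projection R S in
  let q := quantum_coloring_disc (set_projection_system R SS) chi in
  `|complex.Re (\tr (chi *m P))| <= q /\
  complex.Re (\tr (chi *m commutator chi P *m P)) <= q ^+ 2.
Proof.
move=> chiQ SSS P q.
have Pin : P \in projections (set_projection_system R SS).
  by apply/imfsetP; exists S.
have [devE v0] := quantum_dev_sqr _ _ _ chiQ S.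
have devq : quantum_dev chi P <= q.
  rewrite /q /quantum_coloring_disc.
  exact: (@le_bigmax_seq _ R _ (enum_fset (projections (set_projection_system R SS)))
    0 P xpredT (quantum_dev chi) Pin isT).
have dev2q : quantum_dev chi P ^+ 2 <= q ^+ 2.
  by rewrite ler_sqr ?nnegrE ?sqrtr_ge0// (le_trans _ devq)// sqrtr_ge0.
move: dev2q; rewrite devE => dev2q; split; last first.
  by apply: le_trans dev2q; rewrite lerDr sqr_ge0.
rewrite -ler_sqr ?nnegrE ?normr_ge0//; last by rewrite (le_trans _ devq)// sqrtr_ge0.
by rewrite real_normK ?num_real//; apply: le_trans dev2q; rewrite lerDl.
Qed.

Theorem theorem6 (R : realType) :
  exists c : R, 0 < c /\
    forall (N M : nat) (SS : {set {set 'I_N}}),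
      (0 < N)%N -> (0 < M)%N -> #|SS| = M ->
      let q := QDisc (set_projection_system R SS) in
      q != 0 ->
      (Disc SS)%:R <
        (2 * c * Num.max (Num.sqrt (ln (2 * M%:R))) (ln (2 * M%:R) / q) + 1)
        * q.
Proof.
(* The argument yields [5 m q + q], where [m] is the maximum in the statement; [2 * 3 = 6] leaves
   room for strictness. *)
exists 3; split=> // N M SS _ M0 cardSS q q_neq0.
have [chi chiQ [qE _]] := QDisc_min (set_projection_system R SS).
have dev S (SSS : S \in SS) := quantum_coloring_disc_ge _ _ _ _ _ chiQ SSS.
move: dev; rewrite -qE -/q => dev.
have SS0 : (0 < #|SS|)%N by rewrite cardSS.
have q0 : 0 < q.
  have [S SSS] := card_gt0P SS0; have [+ _] := dev S SSS.
  by move=> /(le_trans (normr_ge0 _)); rewrite le_eqVlt eq_sym (negPf q_neq0).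
set L := ln (2 * M%:R).
have L0 : 0 < L.
  by rewrite ln_gt0// -natrM ltr1n; case: M M0 {cardSS L} => // M _; rewrite mulnS.
pose r := Num.sqrt L.
have r0 : 0 < r by rewrite sqrtr_gt0.
have rr : r * r = L by rewrite -expr2 sqr_sqrtr// ltW.
(* Up to a constant, [r / (2 q)] minimises [L / s + 2 s q^2]; the cap keeps [s] where the moment
   bound is valid. *)
pose s := Num.min (4^-1) (r / (2 * q)).
have s0 : 0 < s by rewrite lt_min invr_gt0 ltr0n divr_gt0// mulr_gt0.
have s4 : s <= 4^-1 by rewrite ge_min lexx.
have [f fP] := exists_coloring_near _ _ _ _ s (q ^+ 2) SS0 chiQ s0 s4
  (fun S SSS => (dev S SSS).2).
have := Disc_le _ SS f; rewrite -(ler_nat R) => /le_lt_trans; apply.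
set m := Num.max _ _.
have mr : r * q <= m * q by rewrite ler_pM2r// /m le_max lexx.
have mL : L <= m * q by rewrite -ler_pdivrMr// /m le_max lexx orbT.
have T : (ln (2 * #|SS|%:R) + 2 * s ^+ 2 * q ^+ 2) / s <= 5 * (m * q).
  rewrite cardSS -/L ler_pdivrMr// /s minEle; case: ifPn => [|_].
    rewrite ler_pdivlMr ?mulr_gt0// => h.
    have := ler_wpM2l (ltW q0) h; nra.
  have -> : L + 2 * (r / (2 * q)) ^+ 2 * q ^+ 2 = (3 * (r * q)) * (r / (2 * q)).
    by rewrite -rr; field; rewrite gt_eqF.
  by rewrite ler_pM2r ?divr_gt0 ?mulr_gt0//; nra.
apply: (@le_lt_trans _ _ (5 * (m * q) + q)); last by nra.
apply: coloring_disc_le => [|S SSS]; first by nra.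
(* The colour sum is split into its deviation from the mean, bounded by [T], and the mean, bounded
   by [q]. *)
rewrite -[X in `|X|](subrK (complex.Re (\tr (chi *m set_projection R S)))).
apply: le_trans (ler_normD _ _) _; apply: lerD; last exact: (dev S SSS).1.
exact: le_trans (fP S SSS) T.
Qed.
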